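(* Consider $P:\mathcal R\times\mathcal R\to[0,1]$ as a smooth function on the 6-dimensional manifold $\mathcal R\times\mathcal R$. Every critical point of $P$ is either a global minimum (where $P=0$), a saddle point, a second-order trap, or a global maximum (where $P=\tfrac{3}{50}(9+\sqrt6)$).
   Context: Basis of $\mathbb C^3$: $|1\rangle,|2\rangle,|3\rangle$ (standard basis). Spin-1 matrices in this basis: $J_y=\frac{1}{\sqrt2}\begin{pmatrix}0&-i&0\\ i&0&-i\\ 0&i&0\end{pmatrix}$, $J_z=\mathrm{diag}(1,0,-1)$. Define $Z(\alpha,\beta,\gamma)=e^{-i\alpha J_z}e^{-i\beta J_y}e^{-i\gamma J_z}$. Let $\mathcal R=\{Z(\alpha,\beta,\gamma):\alpha,\beta,\gamma\in\mathbb R\}\subset U(3)$ (the image of $SU(2)$ under its spin-1 representation, a compact 3-dimensional Lie subgroup of $U(3)$). For $j\in\{1,2\}$ let $P_j=|j\rangle\langle j|$ and $\mathcal M_j(\rho)=P_j\rho P_j+(\mathbb I-P_j)\rho(\mathbb I-P_j)$. Define $P(U_1,U_2)=\langle 2|U_2\,\mathcal M_1(U_1|1\rangle\langle 1|U_1^\dagger)\,U_2^\dagger|2\rangle$ for $U_1,U_2\in\mathcal R$. A critical point is a point where the differential of $P$ vanishes; a saddle point is a critical point that is neither a local maximum nor a local minimum; a second-order trap is a critical point that is not a global maximum and at which the Hessian is negative semidefinite but not negative definite. *)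

(* Defs.v *)
From Stdlib Require Import Reals Lra.
From Coquelicot Require Import Coquelicot.
Open Scope R_scope.

(* 3x3 complex matrices, indices 0,1,2 (index k stands for basis vector |k+1>). *)
Definition mat := nat -> nat -> C.

Definition mmul (A B : mat) : mat := fun i j =>
  Cplus (Cplus (Cmult (A i 0%nat) (B 0%nat j)) (Cmult (A i 1%nat) (B 1%nat j)))
        (Cmult (A i 2%nat) (B 2%nat j)).
Definition madd (A B : mat) : mat := fun i j => Cplus (A i j) (B i j).
Definition mscale (c : C) (A : mat) : mat := fun i j => Cmult c (A i j).
Definition madj (A : mat) : mat := fun i j => Cconj (A j i).
Definition mI : mat := fun i j => if Nat.eqb i j then RtoC 1 else RtoC 0.

Fixpoint mpow (A : mat) (n : nat) : mat :=
  match n with O => mI | S n => mmul A (mpow A n) end.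

Definition mexp (A : mat) : mat := fun i j =>
  (Series (fun k => Re (mpow A k i j) / INR (Factorial.fact k)),
   Series (fun k => Im (mpow A k i j) / INR (Factorial.fact k))).

Definition Ci : C := (0, 1).

(* Spin-1 matrices in the standard basis. *)
Definition Jy : mat := fun i j =>
  match i, j with
  | 0%nat, 1%nat => (0, - / sqrt 2)
  | 1%nat, 0%nat => (0, / sqrt 2)
  | 1%nat, 2%nat => (0, - / sqrt 2)
  | 2%nat, 1%nat => (0, / sqrt 2)
  | _, _ => RtoC 0
  end.
Definition Jz : mat := fun i j =>
  match i, j with
  | 0%nat, 0%nat => RtoC 1
  | 2%nat, 2%nat => RtoC (-1)
  | _, _ => RtoC 0
  end.
(* J_x (not given in the paper's context; the standard spin-1 J_x), used only
   to build exponential coordinate charts on the 3-dimensional group R. *)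
Definition Jx : mat := fun i j =>
  match i, j with
  | 0%nat, 1%nat | 1%nat, 0%nat | 1%nat, 2%nat | 2%nat, 1%nat => RtoC (/ sqrt 2)
  | _, _ => RtoC 0
  end.

Definition expmiJ (theta : R) (J : mat) : mat :=
  mexp (mscale (Cmult (RtoC (- theta)) Ci) J).

Definition Zm (a b g : R) : mat :=
  mmul (expmiJ a Jz) (mmul (expmiJ b Jy) (expmiJ g Jz)).

Definition proj (j : nat) : mat := fun a b =>
  if andb (Nat.eqb a j) (Nat.eqb b j) then RtoC 1 else RtoC 0.
Definition mdiff (A B : mat) : mat := fun i j => Cminus (A i j) (B i j).
Definition meas (j : nat) (rho : mat) : mat :=
  madd (mmul (proj j) (mmul rho (proj j)))
       (mmul (mdiff mI (proj j)) (mmul rho (mdiff mI (proj j)))).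

(* P(U1,U2) = <2| U2 M_1(U1 |1><1| U1^dag) U2^dag |2>  (a real number; we take Re). *)
Definition Pfun (U1 U2 : mat) : R :=
  Re (mmul U2 (mmul (meas 0%nat (mmul U1 (mmul (proj 0%nat) (madj U1))))
                     (madj U2)) 1%nat 1%nat).

Definition chartR (U : mat) (x y z : R) : mat :=
  mmul U (mexp (mscale (Cmult (RtoC (-1)) Ci)
                  (madd (mscale (RtoC x) Jx)
                        (madd (mscale (RtoC y) Jy) (mscale (RtoC z) Jz))))).

Definition Ploc (U1 U2 : mat) (v : nat -> R) : R :=
  Pfun (chartR U1 (v 0%nat) (v 1%nat) (v 2%nat))
       (chartR U2 (v 3%nat) (v 4%nat) (v 5%nat)).

Definition ebasis (i : nat) (t : R) : nat -> R :=
  fun k => if Nat.eqb k i then t else 0.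
Definition ebasis2 (i j : nat) (s t : R) : nat -> R :=
  fun k => (if Nat.eqb k i then s else 0) + (if Nat.eqb k j then t else 0).

Definition critical (U1 U2 : mat) : Prop :=
  forall i, (i < 6)%nat -> is_derive (fun t => Ploc U1 U2 (ebasis i t)) 0 0.

Definition hess (U1 U2 : mat) (i j : nat) : R :=
  Derive (fun s => Derive (fun t => Ploc U1 U2 (ebasis2 i j s t)) 0) 0.

Definition quadform (U1 U2 : mat) (v : nat -> R) : R :=
  sum_n (fun i => sum_n (fun j => v i * hess U1 U2 i j * v j) 5) 5.

Definition hess_nsd (U1 U2 : mat) : Prop :=
  forall v : nat -> R, quadform U1 U2 v <= 0.
Definition hess_nd (U1 U2 : mat) : Prop :=
  forall v : nat -> R, (exists i, (i < 6)%nat /\ v i <> 0) -> quadform U1 U2 v < 0.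

Definition local_max (U1 U2 : mat) : Prop :=
  exists eps, 0 < eps /\ forall v : nat -> R,
    (forall k, (k < 6)%nat -> Rabs (v k) < eps) -> Ploc U1 U2 v <= Ploc U1 U2 (fun _ => 0).
Definition local_min (U1 U2 : mat) : Prop :=
  exists eps, 0 < eps /\ forall v : nat -> R,
    (forall k, (k < 6)%nat -> Rabs (v k) < eps) -> Ploc U1 U2 (fun _ => 0) <= Ploc U1 U2 v.

Definition global_max (U1 U2 : mat) : Prop :=
  forall a1 b1 g1 a2 b2 g2, Pfun (Zm a1 b1 g1) (Zm a2 b2 g2) <= Pfun U1 U2.
Definition global_min (U1 U2 : mat) : Prop :=
  forall a1 b1 g1 a2 b2 g2, Pfun U1 U2 <= Pfun (Zm a1 b1 g1) (Zm a2 b2 g2).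

Definition saddle (U1 U2 : mat) : Prop :=
  critical U1 U2 /\ ~ local_max U1 U2 /\ ~ local_min U1 U2.
Definition second_order_trap (U1 U2 : mat) : Prop :=
  critical U1 U2 /\ ~ global_max U1 U2 /\ hess_nsd U1 U2 /\ ~ hess_nd U1 U2.

(* Main.v *)
Require Import Defs.
From Stdlib Require Import Reals Lra Lia Psatz FunctionalExtensionality Classical ClassicalEpsilon.
From Coquelicot Require Import Coquelicot.
Open Scope R_scope.

(* The state U1|1> is determined up to phase by a unit vector n and the row <2|U2 by
   a unit vector m, so P lives on S^2 x S^2 and is a quadratic form in m, with
   coefficients depending on the height c of n.  The phase of U1|1> is a flat
   direction, so the Hessian is never definite.  Hence a critical point that is a
   local maximum is a global maximum or a trap, and one that is neither a local
   maximum nor a local minimum is a saddle.  At a local minimum m is an eigenvector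
   for the smallest eigenvalue of the form; if c <> 1, -1, stationarity in c leaves only
   c^2 + c = 1, where the second derivative in c is negative.  If c = 1 or c = -1 that
   eigenvalue is 0, so P = 0. *)

Definition genK (x y z : R) : mat :=
  mscale (Cmult (RtoC (-1)) Ci)
    (madd (mscale (RtoC x) Jx) (madd (mscale (RtoC y) Jy) (mscale (RtoC z) Jz))).

Definition sinc2 (q : R) : R := PSeries sin_n q.
Definition cosc2 (q : R) : R := PSeries (fun k => - cos_n (S k)) q.

Definition rodr (x y z : R) : mat := fun i j =>
  let q := x * x + y * y + z * z in
  Cplus (mI i j) (Cplus (Cmult (RtoC (sinc2 q)) (genK x y z i j))
    (Cmult (RtoC (cosc2 q)) (mmul (genK x y z) (genK x y z) i j))).

Definition tridiag (x y z : R) : mat := fun i j =>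
  match i, j with
  | 0%nat, 0%nat => (0, - z)
  | 2%nat, 2%nat => (0, z)
  | 0%nat, 1%nat | 1%nat, 2%nat => (- y, - x)
  | 1%nat, 0%nat | 2%nat, 1%nat => (y, - x)
  | _, _ => RtoC 0
  end.

Ltac mat_ext :=
  let i := fresh "i" in let j := fresh "j" in
  apply functional_extensionality; intros i; destruct i as [|[|[|i]]];
  apply functional_extensionality; intros j; destruct j as [|[|[|j]]].

Lemma genK_tridiag x y z : genK x y z = tridiag (x / sqrt 2) (y / sqrt 2) z.
Proof.
mat_ext; unfold genK, mscale, madd, Jx, Jy, Jz, Ci, tridiag, Rdiv;
  generalize (/ sqrt 2); intros h; apply injective_projections; simpl; ring.
Qed.

Lemma inv_sqrt2 : exists r, / sqrt 2 = r / 2 /\ r * r = 2.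
Proof.
exists (sqrt 2); assert (H : sqrt 2 * sqrt 2 = 2) by (apply sqrt_sqrt; lra).
split; [| exact H].
apply Rmult_eq_reg_l with (sqrt 2); [rewrite Rinv_r |]; nra.
Qed.

Lemma div_sqrt2_sqr x y : x / sqrt 2 * (y / sqrt 2) = x * y / 2.
Proof.
transitivity (x * y * (/ sqrt 2 * / sqrt 2)); [unfold Rdiv; ring |].
rewrite <- Rinv_mult, sqrt_sqrt by lra; reflexivity.
Qed.

Lemma tridiag_cube x y z i j :
  mmul (tridiag x y z) (mmul (tridiag x y z) (tridiag x y z)) i j
  = Cmult (RtoC (- (2 * (x * x) + 2 * (y * y) + z * z))) (tridiag x y z i j).
Proof.
destruct i as [|[|[|i]]]; destruct j as [|[|[|j]]];
  unfold mmul, tridiag; apply injective_projections; simpl; ring.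
Qed.

Lemma genK_cube x y z i j :
  mmul (genK x y z) (mmul (genK x y z) (genK x y z)) i j
  = Cmult (RtoC (- (x * x + y * y + z * z))) (genK x y z i j).
Proof.
rewrite genK_tridiag, tridiag_cube, !div_sqrt2_sqr.
do 2 f_equal; field.
Qed.

Lemma mpow_odd_even x y z k i j :
  mpow (genK x y z) (2 * k + 1) i j
    = Cmult (RtoC ((- (x * x + y * y + z * z)) ^ k)) (genK x y z i j) /\
  mpow (genK x y z) (2 * k + 2) i j
    = Cmult (RtoC ((- (x * x + y * y + z * z)) ^ k)) (mmul (genK x y z) (genK x y z) i j).
Proof.
revert i j; set (K := genK x y z); set (q := x * x + y * y + z * z).
assert (step : forall k c, (forall i j, mpow K k i j = Cmult c (K i j)) ->
  forall i j, mpow K (S k) i j = Cmult c (mmul K K i j)).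
{ intros n c H i j; simpl; unfold mmul at 1; rewrite !H; unfold mmul; ring. }
induction k as [|k IH]; intros i j.
- assert (H1 : forall i j, mpow K 1 i j = Cmult (RtoC 1) (K i j)).
  { intros i' j'; simpl; unfold mmul, mI.
    destruct j' as [|[|[|j']]]; simpl; try ring.
    destruct i' as [|[|[|i']]]; unfold K, genK, mscale, madd, Jx, Jy, Jz;
    apply injective_projections; simpl; ring. }
  split; [apply H1 | exact (step 1%nat _ H1 i j)].
- assert (H1 : forall i j, mpow K (2 * S k + 1) i j = Cmult (RtoC ((- q) ^ S k)) (K i j)).
  { intros i' j'. replace (2 * S k + 1)%nat with (S (2 * k + 2)) by lia.
    simpl mpow; unfold mmul at 1.
    rewrite !(proj2 (IH _ _)).
    transitivity (Cmult (RtoC ((- q) ^ k)) (mmul K (mmul K K) i' j')).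
    - unfold mmul at 4; ring.
    - unfold K; rewrite genK_cube; fold K q; simpl pow; rewrite RtoC_mult; ring. }
  split; [apply H1 |].
  replace (2 * S k + 2)%nat with (S (2 * S k + 1)) by lia.
  exact (step _ _ H1 i j).
Qed.

Lemma CV_sin_n : CV_radius sin_n = p_infty.
Proof.
apply CV_radius_infinite_DAlembert.
- intros n; unfold sin_n; apply Rmult_integral_contrapositive_currified.
  + apply pow_nonzero; lra.
  + apply Rinv_neq_0_compat, INR_fact_neq_0.
- apply is_lim_seq_Reals.
  intros e He; destruct (Alembert_sin e He) as [N HN]; exists N; intros n Hn.
  generalize (HN n Hn); unfold Rdist; rewrite !Rminus_0_r, Rabs_Rabsolu; auto.
Qed.

Lemma CV_cos_n : CV_radius cos_n = p_infty.
Proof.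
apply CV_radius_infinite_DAlembert.
- intros n; unfold cos_n; apply Rmult_integral_contrapositive_currified.
  + apply pow_nonzero; lra.
  + apply Rinv_neq_0_compat, INR_fact_neq_0.
- apply is_lim_seq_Reals.
  intros e He; destruct (Alembert_cos e He) as [N HN]; exists N; intros n Hn.
  generalize (HN n Hn); unfold Rdist; rewrite !Rminus_0_r, Rabs_Rabsolu; auto.
Qed.

Lemma CV_cosc2 : CV_radius (fun k => - cos_n (S k)) = p_infty.
Proof.
change (CV_radius (PS_opp (PS_decr_1 cos_n)) = p_infty).
rewrite CV_radius_opp, CV_radius_decr_1; apply CV_cos_n.
Qed.

Lemma is_pseries_infty a x : CV_radius a = p_infty -> is_pseries a x (PSeries a x).
Proof. intros H; apply PSeries_correct, CV_radius_inside; rewrite H; exact I. Qed.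

Lemma sinc2_sin t : t * sinc2 (t * t) = sin t.
Proof.
unfold sin, sinc2; destruct (exist_sin (Rsqr t)) as [a Ha]; f_equal.
apply is_pseries_unique, is_pseries_Reals; exact Ha.
Qed.

Lemma cosc2_cos t : 1 - t * t * cosc2 (t * t) = cos t.
Proof.
unfold cos, cosc2; destruct (exist_cos (Rsqr t)) as [a Ha].
assert (H : PSeries cos_n (t * t) = a).
{ apply is_pseries_unique, is_pseries_Reals; exact Ha. }
rewrite <- H.
rewrite (PSeries_decr_1 cos_n) by (eexists; apply is_pseries_infty, CV_cos_n).
change (fun k => - cos_n (S k)) with (PS_opp (PS_decr_1 cos_n)).
rewrite PSeries_opp; unfold cos_n at 2; simpl; field.
Qed.

Lemma scal_pow_n_1 (k : nat) (y : R) : scal (pow_n (1 ^ 2) k) y = y.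
Proof.
rewrite pow1, pow_n_pow, pow1; apply Rmult_1_l.
Qed.

Lemma series_rodr (q e0 k1 k2 : R) (a : nat -> R) :
  a O = e0 ->
  (forall k, a (2 * k + 1)%nat = (- q) ^ k * k1 / INR (Factorial.fact (2 * k + 1))) ->
  (forall k, a (2 * k + 2)%nat = (- q) ^ k * k2 / INR (Factorial.fact (2 * k + 2))) ->
  Series a = e0 + (sinc2 q * k1 + cosc2 q * k2).
Proof.
intros H0 H1 H2; apply is_series_unique.
assert (E : is_pseries a 1 ((e0 + cosc2 q * k2) + 1 * (sinc2 q * k1))).
{ apply is_pseries_odd_even.
  - assert (E := is_pseries_infty _ q CV_cosc2).
    apply (is_series_ext (fun k => match k with O => e0 | S k => k2 * (- cos_n (S k) * q ^ k) end)).
    { intros [|k].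
      - rewrite scal_pow_n_1; symmetry; exact H0.
      - replace (2 * S k)%nat with (2 * k + 2)%nat by lia.
        rewrite H2, scal_pow_n_1.
        unfold cos_n. replace (2 * S k)%nat with (2 * k + 2)%nat by lia.
        replace ((- q) ^ k) with ((-1) ^ k * q ^ k) by (rewrite <- Rpow_mult_distr; f_equal; ring).
        simpl ((-1) ^ S k); match goal with |- ?l = ?r => change (@eq R l r) end.
        field; apply INR_fact_neq_0. }
    apply is_series_decr_1.
    apply is_pseries_R in E.
    assert (X := is_series_scal_l k2 _ _ E).
    match goal with |- is_series _ ?l => replace l with (scal k2 (cosc2 q)) end;
      [exact X |].
    unfold plus, opp, scal; simpl; unfold mult; simpl; unfold cosc2; ring.
  - assert (E := is_pseries_infty _ q CV_sin_n).
    apply is_pseries_R in E.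
    apply (is_series_ext (fun k => scal k1 (sin_n k * q ^ k))).
    { intros k; rewrite H1. rewrite scal_pow_n_1.
      unfold scal; simpl; unfold mult; simpl. unfold sin_n.
      change (k + (k + 0))%nat with (2 * k)%nat.
      replace ((- q) ^ k) with ((-1) ^ k * q ^ k) by (rewrite <- Rpow_mult_distr; f_equal; ring).
      field. apply INR_fact_neq_0. }
    assert (X := is_series_scal_l k1 _ _ E).
    match goal with |- is_series _ ?l => replace l with (scal k1 (sinc2 q)) end;
      [exact X |].
    unfold scal; simpl; unfold mult; simpl; ring. }
apply is_pseries_R in E.
replace (e0 + (sinc2 q * k1 + cosc2 q * k2)) with (e0 + cosc2 q * k2 + 1 * (sinc2 q * k1)) by ring.
apply (is_series_ext (fun n => a n * 1 ^ n)); [intros n; rewrite pow1; apply Rmult_1_r | exact E].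
Qed.

Lemma mexp_genK x y z : mexp (genK x y z) = rodr x y z.
Proof.
assert (HR : forall a c, Re (Cmult (RtoC a) c) = a * Re c)
  by (intros; unfold Re; simpl; ring).
assert (HI : forall a c, Im (Cmult (RtoC a) c) = a * Im c)
  by (intros; unfold Im; simpl; ring).
apply functional_extensionality; intros i; apply functional_extensionality; intros j.
unfold mexp, rodr.
set (q := x * x + y * y + z * z).
apply injective_projections; symmetry.
- transitivity (Series (fun k => Re (mpow (genK x y z) k i j) / INR (Factorial.fact k)));
    [| reflexivity].
  rewrite (series_rodr q (Re (mI i j)) (Re (genK x y z i j))
    (Re (mmul (genK x y z) (genK x y z) i j))).
  + rewrite <- !HR; reflexivity.
  + simpl; field.
  + intros k; rewrite (proj1 (mpow_odd_even x y z k i j)), HR; reflexivity.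
  + intros k; rewrite (proj2 (mpow_odd_even x y z k i j)), HR; reflexivity.
- transitivity (Series (fun k => Im (mpow (genK x y z) k i j) / INR (Factorial.fact k)));
    [| reflexivity].
  rewrite (series_rodr q (Im (mI i j)) (Im (genK x y z i j))
    (Im (mmul (genK x y z) (genK x y z) i j))).
  + rewrite <- !HI; reflexivity.
  + simpl; field.
  + intros k; rewrite (proj1 (mpow_odd_even x y z k i j)), HI; reflexivity.
  + intros k; rewrite (proj2 (mpow_odd_even x y z k i j)), HI; reflexivity.
Qed.

Definition line (v d : nat -> R) (t : R) : nat -> R := fun k => v k + t * d k.

Fixpoint smooth (n : nat) (f : (nat -> R) -> R) : Prop :=
  match n with
  | O => True
  | S n => exists G : nat -> (nat -> R) -> R,
      (forall v d, is_derive (fun t => f (line v d t)) 0 (sum_n (fun i => d i * G i v) 5))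
      /\ forall i, smooth n (G i)
  end.

Lemma sum_n_5 (f : nat -> R) :
  sum_n f 5 = f 0%nat + f 1%nat + f 2%nat + f 3%nat + f 4%nat + f 5%nat.
Proof. rewrite !sum_Sn, sum_O; reflexivity. Qed.

Lemma line_0 v d : line v d 0 = v.
Proof. apply functional_extensionality; intros k; unfold line; ring. Qed.

Lemma smooth_S n f : smooth (S n) f -> smooth n f.
Proof.
revert f; induction n as [|n IH]; intros f; [intros _; exact I |].
intros (G & H1 & H2); exists G; split; [exact H1 | intros i; apply IH, H2].
Qed.

Lemma smooth_const n c : smooth n (fun _ => c).
Proof.
revert c; induction n as [|n IH]; intros c; [exact I |].
exists (fun _ _ => 0); split; [| intros i; apply IH].
intros v d; rewrite sum_n_5; replace (_ + _) with 0 by ring; apply @is_derive_const.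
Qed.

Lemma smooth_coord n k : (k < 6)%nat -> smooth n (fun v => v k).
Proof.
intros Hk; destruct n as [|n]; [exact I |].
exists (fun i _ => if Nat.eqb i k then 1 else 0); split.
- intros v d; unfold line.
  replace (sum_n _ 5) with (d k).
  + auto_derive; [exact I | ring].
  + rewrite sum_n_5; do 6 (destruct k as [|k]; [simpl; ring |]); lia.
- intros i; destruct (Nat.eqb i k); apply smooth_const.
Qed.

Lemma smooth_plus n f g : smooth n f -> smooth n g -> smooth n (fun v => f v + g v).
Proof.
revert f g; induction n as [|n IH]; intros f g; [intros; exact I |].
intros (F & F1 & F2) (G & G1 & G2); exists (fun i v => F i v + G i v); split.
- intros v d.
  replace (sum_n _ 5) with
    (sum_n (fun i => d i * F i v) 5 + sum_n (fun i => d i * G i v) 5)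
    by (rewrite !sum_n_5; ring).
  exact (is_derive_plus _ _ _ _ _ (F1 v d) (G1 v d)).
- intros i; apply IH; auto.
Qed.

Lemma smooth_mult n f g : smooth n f -> smooth n g -> smooth n (fun v => f v * g v).
Proof.
revert f g; induction n as [|n IH]; intros f g; [intros; exact I |].
intros Hf Hg; pose proof (smooth_S _ _ Hf) as Hf'; pose proof (smooth_S _ _ Hg) as Hg'.
destruct Hf as (F & F1 & F2), Hg as (G & G1 & G2).
exists (fun i v => F i v * g v + f v * G i v); split.
- intros v d.
  replace (sum_n _ 5) with
    (sum_n (fun i => d i * F i v) 5 * g (line v d 0)
     + f (line v d 0) * sum_n (fun i => d i * G i v) 5)
    by (rewrite line_0, !sum_n_5; ring).
  exact (is_derive_mult _ _ _ _ _ (F1 v d) (G1 v d) Rmult_comm).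
- intros i; apply smooth_plus; apply IH; auto.
Qed.

Lemma smooth_opp n f : smooth n f -> smooth n (fun v => - f v).
Proof.
intros H; replace (fun v => - f v) with (fun v => -1 * f v)
  by (apply functional_extensionality; intros; ring).
apply smooth_mult; [apply smooth_const | exact H].
Qed.

Lemma smooth_PSeries n a q :
  CV_radius a = p_infty -> smooth n q -> smooth n (fun v => PSeries a (q v)).
Proof.
revert a; induction n as [|n IH]; intros a Ha; [intros; exact I |].
intros Hq; pose proof (smooth_S _ _ Hq) as Hq'.
destruct Hq as (Q & Q1 & Q2).
exists (fun i v => PSeries (PS_derive a) (q v) * Q i v); split.
- intros v d.
  replace (sum_n _ 5) with (sum_n (fun i => d i * Q i v) 5 * PSeries (PS_derive a) (q (line v d 0)))
    by (rewrite line_0, !sum_n_5; ring).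
  apply (is_derive_comp (PSeries a) (fun t => q (line v d t))).
  + apply is_derive_PSeries; rewrite Ha; exact I.
  + apply Q1.
- intros i; apply smooth_mult; [| apply Q2].
  apply IH; [rewrite CV_radius_derive; exact Ha | exact Hq'].
Qed.

Definition smoothC n (f : (nat -> R) -> C) :=
  smooth n (fun v => Re (f v)) /\ smooth n (fun v => Im (f v)).

Definition smoothM n (M : (nat -> R) -> mat) := forall i j, smoothC n (fun v => M v i j).

Lemma smoothC_plus n f g : smoothC n f -> smoothC n g -> smoothC n (fun v => Cplus (f v) (g v)).
Proof. intros [Hf1 Hf2] [Hg1 Hg2]; split; apply smooth_plus; assumption. Qed.

Lemma smoothC_mult n f g : smoothC n f -> smoothC n g -> smoothC n (fun v => Cmult (f v) (g v)).
Proof.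
intros [Hf1 Hf2] [Hg1 Hg2]; split; simpl; apply smooth_plus;
  try apply smooth_opp; apply smooth_mult; assumption.
Qed.

Lemma smoothC_const n c : smoothC n (fun _ => c).
Proof. split; apply smooth_const. Qed.

Lemma smoothC_real n f : smooth n f -> smoothC n (fun v => RtoC (f v)).
Proof. intros H; split; [exact H | exact (smooth_const n 0)]. Qed.

Lemma smoothM_mmul n A B : smoothM n A -> smoothM n B -> smoothM n (fun v => mmul (A v) (B v)).
Proof.
intros HA HB i j; unfold mmul.
repeat apply smoothC_plus; apply smoothC_mult; first [apply HA | apply HB].
Qed.

Lemma smoothM_madd n A B : smoothM n A -> smoothM n B -> smoothM n (fun v => madd (A v) (B v)).
Proof. intros HA HB i j; apply smoothC_plus; [apply HA | apply HB]. Qed.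

Lemma smoothM_const n A : smoothM n (fun _ => A).
Proof. intros i j; apply smoothC_const. Qed.

Lemma smoothM_madj n A : smoothM n A -> smoothM n (fun v => madj (A v)).
Proof. intros HA i j; split; [apply HA | apply smooth_opp, HA]. Qed.

Lemma smoothM_mscale n f A :
  smoothC n f -> smoothM n A -> smoothM n (fun v => mscale (f v) (A v)).
Proof. intros Hf HA i j; apply smoothC_mult; [exact Hf | apply HA]. Qed.

Lemma smoothM_chartR n U k1 k2 k3 : (k1 < 6)%nat -> (k2 < 6)%nat -> (k3 < 6)%nat ->
  smoothM n (fun v => chartR U (v k1) (v k2) (v k3)).
Proof.
intros H1 H2 H3.
assert (HK : smoothM n (fun v => genK (v k1) (v k2) (v k3))).
{ apply smoothM_mscale; [apply smoothC_const |].
  repeat apply smoothM_madd; apply smoothM_mscale;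
    try apply smoothM_const; apply smoothC_real, smooth_coord; assumption. }
assert (Hq : smooth n (fun v => v k1 * v k1 + v k2 * v k2 + v k3 * v k3)).
{ repeat apply smooth_plus; apply smooth_mult; apply smooth_coord; assumption. }
apply smoothM_mmul; [apply smoothM_const |].
change (smoothM n (fun v => mexp (genK (v k1) (v k2) (v k3)))).
replace (fun v : nat -> R => mexp (genK (v k1) (v k2) (v k3)))
  with (fun v : nat -> R => rodr (v k1) (v k2) (v k3))
  by (apply functional_extensionality; intros; symmetry; apply mexp_genK).
intros i j; unfold rodr.
apply smoothC_plus; [apply smoothC_const |].
apply smoothC_plus; apply smoothC_mult.
- apply smoothC_real, smooth_PSeries; [apply CV_sin_n | exact Hq].
- apply HK.
- apply smoothC_real, smooth_PSeries; [apply CV_cosc2 | exact Hq].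
- apply smoothM_mmul; exact HK.
Qed.

Lemma smooth_Ploc n U1 U2 : smooth n (Ploc U1 U2).
Proof.
assert (H1 : smoothM n (fun v => chartR U1 (v 0%nat) (v 1%nat) (v 2%nat)))
  by (apply smoothM_chartR; lia).
assert (H2 : smoothM n (fun v => chartR U2 (v 3%nat) (v 4%nat) (v 5%nat)))
  by (apply smoothM_chartR; lia).
unfold Ploc, Pfun, meas.
refine (proj1 ((_ : smoothM n (fun v => mmul _ _)) 1%nat 1%nat)).
repeat lazymatch goal with
| |- smoothM _ (fun v => mmul _ _) => apply smoothM_mmul
| |- smoothM _ (fun v => madd _ _) => apply smoothM_madd
| |- smoothM _ (fun v => madj _) => apply smoothM_madj
| |- _ => first [assumption | apply smoothM_const]
end.
Qed.

Lemma local_max_second_order (h h' : R -> R) (l eps : R) :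
  (forall t, is_derive h t (h' t)) -> is_derive h' 0 l -> 0 < eps ->
  (forall t, Rabs t < eps -> h t <= h 0) -> h' 0 = 0 /\ l <= 0.
Proof.
intros Hh Hl He Hmax.
assert (H0 : h' 0 = 0).
{ assert (pr : derivable_pt h 0) by (exists (h' 0); apply is_derive_Reals, Hh).
  rewrite <- (is_derive_unique _ _ _ (Hh 0)), <- (Derive_Reals h 0 pr).
  apply (deriv_maximum h (- eps) eps 0 pr); [lra | lra |].
  intros x Hx1 Hx2; apply Hmax, Rabs_def1; lra. }
split; [exact H0 |].
apply Rnot_lt_le; intros Hpos.
apply is_derive_Reals in Hl.
destruct (Hl (l / 2) ltac:(lra)) as [d Hd].
set (t := Rmin eps d / 2).
assert (Ht : 0 < t < eps /\ t < d).
{ unfold t; pose proof (cond_pos d); pose proof (Rmin_l eps d); pose proof (Rmin_r eps d).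
  assert (0 < Rmin eps d) by (apply Rmin_pos; lra). lra. }
destruct (MVT_cor2 h h' 0 t) as (x & Hx & Hx1); [lra | intros; apply is_derive_Reals, Hh |].
assert (Hmt : h t <= h 0) by (apply Hmax; rewrite Rabs_right; lra).
assert (Hxd : Rabs ((h' (0 + x) - h' 0) / x - l) < l / 2)
  by (apply Hd; [lra | rewrite Rabs_right; lra]).
rewrite Rplus_0_l, H0, Rminus_0_r in Hxd; apply Rabs_def2 in Hxd.
assert (Hq : h' x = h' x / x * x) by (field; lra).
assert (Hpx : 0 < h' x) by (rewrite Hq; apply Rmult_lt_0_compat; lra).
assert (Hpt : 0 < h' x * (t - 0)) by (apply Rmult_lt_0_compat; lra).
lra.
Qed.

Lemma local_min_second_order (h h' : R -> R) (l eps : R) :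
  (forall t, is_derive h t (h' t)) -> is_derive h' 0 l -> 0 < eps ->
  (forall t, Rabs t < eps -> h 0 <= h t) -> h' 0 = 0 /\ 0 <= l.
Proof.
intros Hh Hl He Hmin.
destruct (local_max_second_order (fun t => - h t) (fun t => - h' t) (- l) eps).
- intros t; exact (is_derive_opp _ _ _ (Hh t)).
- exact (is_derive_opp _ _ _ Hl).
- exact He.
- intros t Ht; specialize (Hmin t Ht); lra.
- lra.
Qed.

Lemma is_derive_line f G v d t :
  (forall v d, is_derive (fun t => f (line v d t)) 0 (sum_n (fun i => d i * G i v) 5)) ->
  is_derive (fun t => f (line v d t)) t (sum_n (fun i => d i * G i (line v d t)) 5).
Proof.
intros H; specialize (H (line v d t) d).
apply (is_derive_ext (fun s => f (line (line v d t) d (s - t)))).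
{ intros s; f_equal; apply functional_extensionality; intros k; unfold line.
  match goal with |- ?a = ?b => change (@eq R a b) end; ring. }
replace (sum_n _ 5) with (scal 1 (sum_n (fun i => d i * G i (line v d t)) 5))
  by (apply Rmult_1_l).
apply (is_derive_comp (fun u => f (line (line v d t) d u)) (fun s => s - t)).
- replace (t - t) with 0 by ring; exact H.
- auto_derive; [exact I | ring].
Qed.

Lemma local_max_hess_nsd U1 U2 : local_max U1 U2 -> hess_nsd U1 U2.
Proof.
intros (eps & He & Hmax) v.
destruct (smooth_Ploc 2 U1 U2) as (G & HG & HG2).
assert (HH : forall i, exists H : nat -> (nat -> R) -> R, forall v d,
  is_derive (fun t => G i (line v d t)) 0 (sum_n (fun j => d j * H j v) 5)).
{ intros i; destruct (HG2 i) as (H & H1 & _); exists H; exact H1. }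
set (H := fun i => proj1_sig (constructive_indefinite_description _ (HH i))).
assert (HH' := fun i => proj2_sig (constructive_indefinite_description _ (HH i))).
change (forall i v d, is_derive (fun t => G i (line v d t)) 0
  (sum_n (fun j => d j * H i j v) 5)) in HH'.
clearbody H; clear HG2 HH.
set (o := fun _ : nat => 0).
assert (Hhess : forall i j, (i < 6)%nat -> (j < 6)%nat -> hess U1 U2 i j = H j i o).
{ intros i j Hi Hj; unfold hess.
  rewrite (Derive_ext _ (fun s => G j (line o (fun k => if Nat.eqb k i then 1 else 0) s))).
  - rewrite (is_derive_unique _ _ _ (HH' j o _)), sum_n_5.
    do 6 (destruct i as [|i]; [simpl; ring |]); lia.
  - intros s.
    rewrite (Derive_ext _ (fun t => Ploc U1 U2
      (line (line o (fun k => if Nat.eqb k i then 1 else 0) s)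
            (fun k => if Nat.eqb k j then 1 else 0) t))).
    + rewrite (is_derive_unique _ _ _ (HG _ _)), sum_n_5.
      do 6 (destruct j as [|j]; [simpl; ring |]); lia.
    + intros t; f_equal; apply functional_extensionality; intros k.
      unfold ebasis2, line, o; destruct (Nat.eqb k i), (Nat.eqb k j);
      match goal with |- ?a = ?b => change (@eq R a b) end; ring. }
set (N := 1 + Rabs (v 0%nat) + Rabs (v 1%nat) + Rabs (v 2%nat)
          + Rabs (v 3%nat) + Rabs (v 4%nat) + Rabs (v 5%nat)).
assert (HN : 1 <= N /\ forall k, (k < 6)%nat -> Rabs (v k) <= N).
{ unfold N; assert (X := fun k => Rabs_pos (v k)).
  pose proof (X 0%nat); pose proof (X 1%nat); pose proof (X 2%nat);
  pose proof (X 3%nat); pose proof (X 4%nat); pose proof (X 5%nat).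
  split; [lra |].
  intros k Hk; do 6 (destruct k as [|k]; [lra |]); lia. }
destruct HN as [HN1 HN].
destruct (local_max_second_order (fun t => Ploc U1 U2 (line o v t))
  (fun t => sum_n (fun i => v i * G i (line o v t)) 5) (quadform U1 U2 v) (eps / N)) as [_ Hq].
- intros t; apply is_derive_line, HG.
- apply (is_derive_ext (fun t => v 0%nat * G 0%nat (line o v t) + v 1%nat * G 1%nat (line o v t)
    + v 2%nat * G 2%nat (line o v t) + v 3%nat * G 3%nat (line o v t)
    + v 4%nat * G 4%nat (line o v t) + v 5%nat * G 5%nat (line o v t))).
  { intros t; rewrite sum_n_5; reflexivity. }
  replace (quadform U1 U2 v) with
    (v 0%nat * sum_n (fun j => v j * H 0%nat j o) 5 + v 1%nat * sum_n (fun j => v j * H 1%nat j o) 5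
     + v 2%nat * sum_n (fun j => v j * H 2%nat j o) 5 + v 3%nat * sum_n (fun j => v j * H 3%nat j o) 5
     + v 4%nat * sum_n (fun j => v j * H 4%nat j o) 5 + v 5%nat * sum_n (fun j => v j * H 5%nat j o) 5).
  + repeat apply @is_derive_plus;
      match goal with |- is_derive (fun t => v ?i * _) _ _ =>
        apply (is_derive_scal (fun t => G i (line o v t)) 0 (v i)), HH' end.
  + unfold quadform; rewrite !sum_n_5, !Hhess by lia; ring.
- apply Rdiv_lt_0_compat; lra.
- intros t Ht; rewrite line_0; apply Hmax.
  intros k Hk; unfold line, o; rewrite Rplus_0_l, Rabs_mult.
  apply Rle_lt_trans with (Rabs t * N).
  + apply Rmult_le_compat_l; [apply Rabs_pos | auto].
  + apply Rmult_lt_reg_r with (/ N); [apply Rinv_0_lt_compat; lra |].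
    rewrite Rmult_assoc, Rinv_r, Rmult_1_r by lra; exact Ht.
- exact Hq.
Qed.

Definition expJz (t : R) : mat := fun i j =>
  match i, j with
  | 0%nat, 0%nat => (cos t, - sin t)
  | 2%nat, 2%nat => (cos t, sin t)
  | _, _ => mI i j
  end.

Definition expJy (t : R) : mat := fun i j =>
  match i, j with
  | 0%nat, 0%nat | 2%nat, 2%nat => RtoC ((1 + cos t) / 2)
  | 0%nat, 2%nat | 2%nat, 0%nat => RtoC ((1 - cos t) / 2)
  | 0%nat, 1%nat | 1%nat, 2%nat => RtoC (- (sin t / sqrt 2))
  | 1%nat, 0%nat | 2%nat, 1%nat => RtoC (sin t / sqrt 2)
  | 1%nat, 1%nat => RtoC (cos t)
  | _, _ => mI i j
  end.

Lemma expmiJ_Jz t : expmiJ t Jz = expJz t.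
Proof.
unfold expmiJ.
replace (mscale _ Jz) with (genK 0 0 t).
- rewrite mexp_genK.
  pose proof (sinc2_sin t) as Hs; pose proof (cosc2_cos t) as Hc.
  unfold rodr; replace (0 * 0 + 0 * 0 + t * t) with (t * t) by ring.
  set (A := sinc2 (t * t)) in *; set (B := cosc2 (t * t)) in *; clearbody A B.
  rewrite genK_tridiag; replace (0 / sqrt 2) with 0 by (unfold Rdiv; ring).
  mat_ext; unfold expJz; rewrite <- ?Hs, <- ?Hc;
    unfold mI, mmul, tridiag; apply injective_projections; simpl; ring.
- mat_ext; unfold genK, mscale, madd, Jx, Jy, Jz, Ci;
    apply injective_projections; simpl; ring.
Qed.

Lemma expmiJ_Jy t : expmiJ t Jy = expJy t.
Proof.
unfold expmiJ.
replace (mscale _ Jy) with (genK 0 t 0).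
- rewrite mexp_genK.
  pose proof (sinc2_sin t) as Hs; pose proof (cosc2_cos t) as Hc.
  pose proof (div_sqrt2_sqr t t) as Hh.
  unfold rodr; replace (0 * 0 + t * t + 0 * 0) with (t * t) by ring.
  set (A := sinc2 (t * t)) in *; set (B := cosc2 (t * t)) in *; clearbody A B.
  rewrite genK_tridiag; replace (0 / sqrt 2) with 0 by (unfold Rdiv; ring).
  assert (E1 : sin t / sqrt 2 = A * (t / sqrt 2)) by (rewrite <- Hs; unfold Rdiv; ring).
  set (h := t / sqrt 2) in *; clearbody h.
  assert (E2 : cos t = 1 - 2 * (B * (h * h))) by (rewrite <- Hc, Hh; field).
  assert (E3 : (1 + cos t) / 2 = 1 - B * (h * h)) by (rewrite E2; field).
  assert (E4 : (1 - cos t) / 2 = B * (h * h)) by (rewrite E2; field).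
  mat_ext; unfold expJy; rewrite ?E1, ?E3, ?E4, ?E2;
    unfold mI, mmul, tridiag; apply injective_projections; simpl; ring.
- mat_ext; unfold genK, mscale, madd, Jx, Jy, Jz, Ci;
    apply injective_projections; simpl; ring.
Qed.

(* The state [U|1>] with spin direction [(s cos a, s sin a, c)], up to the phase [exp (-i g)]. *)
Definition is_state (U : mat) (a g c s : R) : Prop :=
  U 0%nat 0%nat = Cmult (cos a, - sin a) (Cmult (cos g, - sin g) (RtoC ((1 + c) / 2))) /\
  U 1%nat 0%nat = Cmult (cos g, - sin g) (RtoC (s / sqrt 2)) /\
  U 2%nat 0%nat = Cmult (cos a, sin a) (Cmult (cos g, - sin g) (RtoC ((1 - c) / 2))).

(* The row [<2|U] attached to the real vector [(m1, m2, m3)]: the spin-1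
   representation is the complexification of [R^3], with [|2>] the image of [e3]. *)
Definition is_row (U : mat) (m1 m2 m3 : R) : Prop :=
  U 1%nat 0%nat = (m1 / sqrt 2, - (m2 / sqrt 2)) /\
  U 1%nat 1%nat = (m3, 0) /\
  U 1%nat 2%nat = (- (m1 / sqrt 2), - (m2 / sqrt 2)).

Lemma Zm_state a b g : is_state (Zm a b g) a g (cos b) (sin b).
Proof.
unfold Zm; rewrite !expmiJ_Jz, expmiJ_Jy; unfold is_state, mmul, expJz, expJy, mI.
repeat split; apply injective_projections; simpl; ring.
Qed.

Lemma Zm_row a b g : is_row (Zm a b g) (sin b * cos g) (sin b * sin g) (cos b).
Proof.
unfold Zm; rewrite !expmiJ_Jz, expmiJ_Jy; unfold is_row, mmul, expJz, expJy, mI, Rdiv.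
repeat split; apply injective_projections; simpl; ring.
Qed.

Definition Pform (c s p q z : R) : R :=
  (p * p + q * q) * (1 + c * c) / 4 + z * z * (s * s) / 2 - z * s * (1 - c) * p / 2.

Definition abs2 (w : C) : R := Re w * Re w + Im w * Im w.

Lemma pure_state U i j :
  mmul U (mmul (proj 0) (madj U)) i j = Cmult (U i 0%nat) (Cconj (U j 0%nat)).
Proof. unfold mmul, proj, madj; simpl; ring. Qed.

Lemma meas_entry rho i j : (i < 3)%nat -> (j < 3)%nat ->
  meas 0 rho i j = if Bool.eqb (Nat.eqb i 0) (Nat.eqb j 0) then rho i j else RtoC 0.
Proof.
intros Hi Hj; destruct i as [|[|[|i]]]; [| | | lia]; (destruct j as [|[|[|j]]]; [| | | lia]);
  unfold meas, mmul, madd, mdiff, mI, proj; simpl; ring.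
Qed.

Lemma Pfun_abs2 U1 U2 : Pfun U1 U2 =
  abs2 (Cmult (U2 1%nat 0%nat) (U1 0%nat 0%nat))
  + abs2 (Cplus (Cmult (U2 1%nat 1%nat) (U1 1%nat 0%nat))
                (Cmult (U2 1%nat 2%nat) (U1 2%nat 0%nat))).
Proof.
unfold Pfun; generalize (pure_state U1).
generalize (mmul U1 (mmul (proj 0) (madj U1))); intros rho Hrho.
unfold mmul, madj; rewrite !meas_entry by lia; simpl Nat.eqb; cbv beta iota delta [Bool.eqb].
rewrite !Hrho.
generalize (U1 0%nat 0%nat) (U1 1%nat 0%nat) (U1 2%nat 0%nat)
  (U2 1%nat 0%nat) (U2 1%nat 1%nat) (U2 1%nat 2%nat); intros u0 u1 u2 r0 r1 r2.
transitivity (Re (Cplus (Cmult (Cmult r0 u0) (Cconj (Cmult r0 u0)))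
  (Cmult (Cplus (Cmult r1 u1) (Cmult r2 u2)) (Cconj (Cplus (Cmult r1 u1) (Cmult r2 u2)))))).
- f_equal; rewrite Cplus_conj, !Cmult_conj; ring.
- generalize (Cmult r0 u0) (Cplus (Cmult r1 u1) (Cmult r2 u2)); intros [a b] [c d].
  unfold abs2; simpl; ring.
Qed.

Lemma Pfun_nonneg U1 U2 : 0 <= Pfun U1 U2.
Proof. rewrite Pfun_abs2; unfold abs2; nra. Qed.

Lemma abs2_mult u w : abs2 (Cmult u w) = abs2 u * abs2 w.
Proof. unfold abs2; destruct u, w; simpl; ring. Qed.

Lemma abs2_phase t : abs2 (cos t, - sin t) = 1.
Proof. pose proof (sin2_cos2 t); unfold abs2, Rsqr in *; simpl; lra. Qed.

Lemma Pfun_Pform U1 U2 a g c s m1 m2 m3 :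
  is_state U1 a g c s -> is_row U2 m1 m2 m3 ->
  Pfun U1 U2 = Pform c s (m1 * cos a - m2 * sin a) (m1 * sin a + m2 * cos a) m3.
Proof.
intros (A1 & A2 & A3) (B1 & B2 & B3); rewrite Pfun_abs2, A1, A2, A3, B1, B2, B3.
match goal with |- _ + abs2 ?w = _ => replace w with
  (Cmult (cos g, - sin g) (Cplus (RtoC (m3 * (s / sqrt 2)))
    (Cmult (- (m1 / sqrt 2), - (m2 / sqrt 2)) (Cmult (cos a, sin a) (RtoC ((1 - c) / 2))))))
  by (apply injective_projections; simpl; ring) end.
rewrite !abs2_mult, !abs2_phase, !Rmult_1_l.
destruct inv_sqrt2 as (r & Hr & H2); unfold abs2, Pform, Rdiv; simpl; rewrite Hr.
pose proof (sin2_cos2 a) as Ha; unfold Rsqr in *.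
set (p := m1 * cos a - m2 * sin a); set (q := m1 * sin a + m2 * cos a).
assert (Hpq : m1 * m1 + m2 * m2 = p * p + q * q).
{ transitivity ((m1 * m1 + m2 * m2) * (sin a * sin a + cos a * cos a));
    [rewrite Ha | unfold p, q]; ring. }
match goal with |- _ + (?x * ?x + ?y * ?y) = _ =>
  replace x with (r / 2 * (m3 * s - p * ((1 - c) / 2))) by (unfold p; field);
  replace y with (r / 2 * (- (q * ((1 - c) / 2)))) by (unfold q; field) end.
transitivity (r * r / 4 * ((m1 * m1 + m2 * m2) * (((1 + c) / 2) * ((1 + c) / 2))
  + (m3 * s - p * ((1 - c) / 2)) * (m3 * s - p * ((1 - c) / 2))
  + (q * ((1 - c) / 2)) * (q * ((1 - c) / 2)))); [field |].
rewrite H2, Hpq; field.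
Qed.

Lemma mmul_assoc A B D i j : mmul A (mmul B D) i j = mmul (mmul A B) D i j.
Proof. unfold mmul; ring. Qed.

(* [J_x] acts on rows with the opposite sign, hence the axis [(-x, y, z)]. *)
Lemma is_row_genK U m1 m2 m3 x y z : is_row U m1 m2 m3 ->
  is_row (mmul U (genK x y z)) (y * m3 - z * m2) (z * m1 + x * m3) (- x * m2 - y * m1).
Proof.
intros (B1 & B2 & B3); destruct inv_sqrt2 as (r & Hr & H2).
unfold is_row, mmul; rewrite B1, B2, B3; unfold genK, mscale, madd, Jx, Jy, Jz, Ci, Rdiv.
repeat split; apply injective_projections; simpl; rewrite Hr; field [H2].
Qed.

Lemma is_row_chartR U m1 m2 m3 x y z : is_row U m1 m2 m3 ->
  let q := x * x + y * y + z * z in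
  let k1 := y * m3 - z * m2 in let k2 := z * m1 + x * m3 in let k3 := - x * m2 - y * m1 in
  is_row (chartR U x y z)
    (m1 + sinc2 q * k1 + cosc2 q * (y * k3 - z * k2))
    (m2 + sinc2 q * k2 + cosc2 q * (z * k1 + x * k3))
    (m3 + sinc2 q * k3 + cosc2 q * (- x * k2 - y * k1)).
Proof.
intros HU q k1 k2 k3.
pose proof (is_row_genK _ _ _ _ x y z HU) as H1.
pose proof (is_row_genK _ _ _ _ x y z H1) as H2.
fold k1 k2 k3 in H1, H2.
assert (E : forall j, (j < 3)%nat -> chartR U x y z 1%nat j =
  Cplus (U 1%nat j) (Cplus (Cmult (RtoC (sinc2 q)) (mmul U (genK x y z) 1%nat j))
    (Cmult (RtoC (cosc2 q)) (mmul (mmul U (genK x y z)) (genK x y z) 1%nat j)))).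
{ intros j Hj; unfold chartR; change (mscale _ _) with (genK x y z).
  rewrite mexp_genK, <- mmul_assoc; unfold rodr; fold q.
  set (K2 := mmul (genK x y z) (genK x y z)).
  unfold mmul.
  destruct j as [|[|[|j]]]; [| | | lia]; unfold mI; simpl Nat.eqb; cbv iota; ring. }
destruct HU as (B1 & B2 & B3), H1 as (D1 & D2 & D3), H2 as (F1 & F2 & F3).
unfold is_row; rewrite !E by lia; rewrite B1, B2, B3, D1, D2, D3, F1, F2, F3.
unfold Rdiv; repeat split; apply injective_projections; simpl; ring.
Qed.

Lemma is_row_chartR_0 U m1 m2 m3 : is_row U m1 m2 m3 -> is_row (chartR U 0 0 0) m1 m2 m3.
Proof.
intros H; pose proof (is_row_chartR _ _ _ _ 0 0 0 H) as X; cbv zeta in X.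
match type of X with is_row _ ?a ?b ?c =>
  replace a with m1 in X by ring; replace b with m2 in X by ring;
  replace c with m3 in X by ring end.
exact X.
Qed.

(* The axis of the rotation is [m x u]. *)
Lemma is_row_great_circle U m1 m2 m3 u1 u2 u3 t : is_row U m1 m2 m3 ->
  m1 * m1 + m2 * m2 + m3 * m3 = 1 -> u1 * u1 + u2 * u2 + u3 * u3 = 1 ->
  m1 * u1 + m2 * u2 + m3 * u3 = 0 ->
  is_row (chartR U (t * (m3 * u2 - m2 * u3)) (t * (m3 * u1 - m1 * u3)) (t * (m1 * u2 - m2 * u1)))
    (cos t * m1 + sin t * u1) (cos t * m2 + sin t * u2) (cos t * m3 + sin t * u3).
Proof.
intros HU Hm Hu Ho.
set (x := m3 * u2 - m2 * u3); set (y := m3 * u1 - m1 * u3); set (z := m1 * u2 - m2 * u1).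
pose proof (is_row_chartR _ _ _ _ (t * x) (t * y) (t * z) HU) as X; cbv zeta in X.
assert (Hq : x * x + y * y + z * z = 1).
{ transitivity ((m1 * m1 + m2 * m2 + m3 * m3) * (u1 * u1 + u2 * u2 + u3 * u3)
    - (m1 * u1 + m2 * u2 + m3 * u3) * (m1 * u1 + m2 * u2 + m3 * u3));
    [unfold x, y, z; ring | rewrite Hm, Hu, Ho; ring]. }
replace (t * x * (t * x) + t * y * (t * y) + t * z * (t * z)) with (t * t) in X
  by (transitivity (t * t * (x * x + y * y + z * z)); [rewrite Hq |]; ring).
pose proof (sinc2_sin t) as Hs; pose proof (cosc2_cos t) as Hc.
set (A := sinc2 (t * t)) in *; set (B := cosc2 (t * t)) in *; clearbody A B.
assert (K1 : y * m3 - z * m2 = u1).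
{ transitivity (u1 * (m1 * m1 + m2 * m2 + m3 * m3) - m1 * (m1 * u1 + m2 * u2 + m3 * u3));
    [unfold y, z; ring | rewrite Hm, Ho; ring]. }
assert (K2 : z * m1 + x * m3 = u2).
{ transitivity (u2 * (m1 * m1 + m2 * m2 + m3 * m3) - m2 * (m1 * u1 + m2 * u2 + m3 * u3));
    [unfold x, z; ring | rewrite Hm, Ho; ring]. }
assert (K3 : - x * m2 - y * m1 = u3).
{ transitivity (u3 * (m1 * m1 + m2 * m2 + m3 * m3) - m3 * (m1 * u1 + m2 * u2 + m3 * u3));
    [unfold x, y; ring | rewrite Hm, Ho; ring]. }
assert (L1 : y * u3 - z * u2 = - m1).
{ transitivity (u1 * (m1 * u1 + m2 * u2 + m3 * u3) - m1 * (u1 * u1 + u2 * u2 + u3 * u3));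
    [unfold y, z; ring | rewrite Hu, Ho; ring]. }
assert (L2 : z * u1 + x * u3 = - m2).
{ transitivity (u2 * (m1 * u1 + m2 * u2 + m3 * u3) - m2 * (u1 * u1 + u2 * u2 + u3 * u3));
    [unfold x, z; ring | rewrite Hu, Ho; ring]. }
assert (L3 : - x * u2 - y * u1 = - m3).
{ transitivity (u3 * (m1 * u1 + m2 * u2 + m3 * u3) - m3 * (u1 * u1 + u2 * u2 + u3 * u3));
    [unfold x, y; ring | rewrite Hu, Ho; ring]. }
replace (t * y * m3 - t * z * m2) with (t * u1) in X by (rewrite <- K1; ring).
replace (t * z * m1 + t * x * m3) with (t * u2) in X by (rewrite <- K2; ring).
replace (- (t * x) * m2 - t * y * m1) with (t * u3) in X by (rewrite <- K3; ring).
replace (t * y * (t * u3) - t * z * (t * u2)) with (t * t * - m1) in X by (rewrite <- L1; ring).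
replace (t * z * (t * u1) + t * x * (t * u3)) with (t * t * - m2) in X by (rewrite <- L2; ring).
replace (- (t * x) * (t * u2) - t * y * (t * u1)) with (t * t * - m3) in X by (rewrite <- L3; ring).
clear K1 K2 K3 L1 L2 L3 Hq; clearbody x y z.
rewrite <- Hs, <- Hc.
match type of X with is_row _ ?a ?b ?c =>
  match goal with |- is_row _ ?a' ?b' ?c' =>
  replace a' with a by ring; replace b' with b by ring; replace c' with c by ring end end.
exact X.
Qed.

Lemma is_state_chartR_z U a g c s w : is_state U a g c s ->
  is_state (chartR U 0 0 w) a (g + w) c s.
Proof.
intros (A1 & A2 & A3).
assert (E : forall i, chartR U 0 0 w i 0%nat = Cmult (U i 0%nat) (cos w, - sin w)).
{ intros i; unfold chartR; change (mscale _ _) with (genK 0 0 w).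
  replace (genK 0 0 w) with (mscale (Cmult (RtoC (- w)) Ci) Jz).
  - change (mexp _) with (expmiJ w Jz); rewrite expmiJ_Jz; unfold mmul, expJz, mI; simpl; ring.
  - mat_ext; unfold genK, mscale, madd, Jx, Jy, Jz, Ci;
    apply injective_projections; simpl; ring. }
unfold is_state; rewrite !E, A1, A2, A3, cos_plus, sin_plus.
repeat split; apply injective_projections; simpl; ring.
Qed.

Lemma rodr_col0 t g :
  let col := fun i => rodr (t * sin g) (t * cos g) 0 i 0%nat in
  col 0%nat = RtoC ((1 + cos t) / 2) /\
  col 1%nat = Cmult (cos g, - sin g) (RtoC (sin t / sqrt 2)) /\
  col 2%nat = Cmult (cos g, - sin g) (Cmult (cos g, - sin g) (RtoC ((1 - cos t) / 2))).
Proof.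
intros col; unfold col, rodr; clear col.
pose proof (sin2_cos2 g) as Hg; unfold Rsqr in Hg.
replace (t * sin g * (t * sin g) + t * cos g * (t * cos g) + 0 * 0) with (t * t)
  by (transitivity (t * t * (sin g * sin g + cos g * cos g)); [rewrite Hg |]; ring).
pose proof (sinc2_sin t) as Hs; pose proof (cosc2_cos t) as Hc.
set (A := sinc2 (t * t)) in *; set (B := cosc2 (t * t)) in *; clearbody A B.
assert (Hg' : sin g * sin g = 1 - cos g * cos g) by lra.
destruct inv_sqrt2 as (r & Hr & H2).
unfold mI, mmul, genK, mscale, madd, Jx, Jy, Jz, Ci, Rdiv; rewrite <- Hs, <- Hc.
repeat split; apply injective_projections; simpl; rewrite ?Hr; field [H2 Hg'].
Qed.

Lemma expJy_plus b t k : (k < 3)%nat ->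
  mmul (expJy b) (expJy t) k 0%nat = expJy (b + t) k 0%nat.
Proof.
intros Hk; destruct inv_sqrt2 as (r & Hr & H2).
unfold mmul, expJy, Rdiv; rewrite Hr, cos_plus, sin_plus.
destruct k as [|[|[|k]]]; [| | | lia];
  apply injective_projections; simpl; field [H2].
Qed.

(* [exp(-i g J_z)] conjugates [sin g J_x + cos g J_y] to [J_y]. *)
Lemma is_state_chartR_Zm a b g t :
  is_state (chartR (Zm a b g) (t * sin g) (t * cos g) 0) a g (cos (b + t)) (sin (b + t)).
Proof.
assert (Hg : Cmult (cos g, sin g) (cos g, - sin g) = RtoC 1).
{ pose proof (sin2_cos2 g) as Hg; unfold Rsqr in Hg.
  apply injective_projections; simpl; lra. }
assert (C : forall k, (k < 3)%nat ->
  mmul (expJz g) (rodr (t * sin g) (t * cos g) 0) k 0%nat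
  = Cmult (cos g, - sin g) (expJy t k 0%nat)).
{ intros k Hk; destruct (rodr_col0 t g) as (C0 & C1 & C2); cbv beta in C0, C1, C2.
  unfold mmul; rewrite C0, C1, C2.
  destruct k as [|[|[|k]]]; [| | | lia]; unfold expJz, expJy, mI; simpl Nat.eqb; cbv iota.
  - ring.
  - ring.
  - match goal with |- ?l = ?r => transitivity (Cmult r (Cmult (cos g, sin g) (cos g, - sin g))) end;
      [ring | rewrite Hg; ring]. }
assert (E : forall k, chartR (Zm a b g) (t * sin g) (t * cos g) 0 k 0%nat =
  Cmult (cos g, - sin g) (mmul (expJz a) (expJy (b + t)) k 0%nat)).
{ intros k; unfold chartR; change (mscale _ _) with (genK (t * sin g) (t * cos g) 0).
  rewrite mexp_genK; unfold Zm; rewrite !expmiJ_Jz, expmiJ_Jy.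
  rewrite <- mmul_assoc; unfold mmul at 1; rewrite <- !mmul_assoc.
  unfold mmul at 1 3 5; rewrite !C by lia.
  unfold mmul at 1; rewrite <- !expJy_plus by lia; unfold mmul; ring. }
unfold is_state; rewrite !E; unfold mmul, expJz, expJy, mI.
repeat split; apply injective_projections; simpl; ring.
Qed.

Lemma is_state_chartR_0 a b g : is_state (chartR (Zm a b g) 0 0 0) a g (cos b) (sin b).
Proof.
pose proof (is_state_chartR_Zm a b g 0) as H.
rewrite !Rmult_0_l, Rplus_0_r in H; exact H.
Qed.

Lemma Ploc_0 a1 b1 g1 a2 b2 g2 :
  Ploc (Zm a1 b1 g1) (Zm a2 b2 g2) (fun _ => 0) = Pfun (Zm a1 b1 g1) (Zm a2 b2 g2).
Proof.
unfold Ploc.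
rewrite (Pfun_Pform _ _ _ _ _ _ _ _ _ (is_state_chartR_0 a1 b1 g1)
  (is_row_chartR_0 _ _ _ _ (Zm_row a2 b2 g2))).
symmetry; apply (Pfun_Pform _ _ _ _ _ _ _ _ _ (Zm_state a1 b1 g1) (Zm_row a2 b2 g2)).
Qed.

(* The generator [J_z] in the first factor only multiplies [U1|1>] by a phase. *)
Lemma not_hess_nd a1 b1 g1 a2 b2 g2 : ~ hess_nd (Zm a1 b1 g1) (Zm a2 b2 g2).
Proof.
set (U1 := Zm a1 b1 g1); set (U2 := Zm a2 b2 g2).
assert (H : hess U1 U2 2 2 = 0).
{ unfold hess; rewrite (Derive_ext _ (fun _ => 0)); [apply Derive_const |].
  intros s; rewrite (Derive_ext _ (fun _ => Ploc U1 U2 (fun _ => 0))); [apply Derive_const |].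
  intros t; unfold U1, U2; rewrite Ploc_0; unfold Ploc, ebasis2; simpl Nat.eqb; cbv iota.
  rewrite Rplus_0_r.
  rewrite (Pfun_Pform _ _ _ _ _ _ _ _ _ (is_state_chartR_z _ _ _ _ _ (s + t) (Zm_state a1 b1 g1))
    (is_row_chartR_0 _ _ _ _ (Zm_row a2 b2 g2))).
  symmetry; apply (Pfun_Pform _ _ _ _ _ _ _ _ _ (Zm_state a1 b1 g1) (Zm_row a2 b2 g2)). }
intros Hnd.
assert (X : quadform U1 U2 (fun k => if Nat.eqb k 2 then 1 else 0) < 0).
{ apply Hnd; exists 2%nat; split; [lia | simpl; lra]. }
unfold quadform in X; rewrite !sum_n_5 in X; simpl Nat.eqb in X; cbv iota in X.
rewrite H in X; lra.
Qed.

Lemma sqrt6_bounds : sqrt 6 * sqrt 6 = 6 /\ 2.4 < sqrt 6 < 2.5.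
Proof.
assert (H : sqrt 6 * sqrt 6 = 6) by (apply sqrt_sqrt; lra).
pose proof (sqrt_pos 6); split; [exact H | split; nra].
Qed.

(* [(1 - sqrt 6) / 5] is a double root in [c] of the determinant of
   [M - Pform c s], where [M] is the claimed maximum. *)
Lemma Pform_le c s p q z : c * c + s * s = 1 -> p * p + q * q + z * z = 1 ->
  Pform c s p q z <= 3 / 50 * (9 + sqrt 6).
Proof.
intros Hcs Hm; destruct sqrt6_bounds as (Hw & Hw1 & Hw2).
set (w := sqrt 6) in *; clearbody w.
set (M := 3 / 50 * (9 + w)).
set (A := M - (1 + c * c) / 4); set (D := M - s * s / 2); set (b := s * (1 - c) / 4).
assert (HM : 0.68 < M < 0.7) by (unfold M; lra).
assert (Hc : -1 <= c <= 1) by nra.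
assert (HA : 0 < A) by (unfold A; nra).
assert (HD : 0 < D) by (unfold D; nra).
assert (Hdet : 0 <= A * D - b * b).
{ replace (A * D - b * b) with
    (/ 16 * ((c - (1 - w) / 5) * (c - (1 - w) / 5)
     * (- (c * c) + (2 * w - 12) / 5 * c + (13 + 32 * w) / 25))).
  - apply Rmult_le_pos; [lra |]; apply Rmult_le_pos; [apply Rle_0_sqr |].
    assert (0 <= (12 - 2 * w) / 5 * (1 - c)) by (apply Rmult_le_pos; lra).
    assert (c * c <= 1) by nra.
    lra.
  - unfold A, D, b, M.
    replace (s * (1 - c) / 4 * (s * (1 - c) / 4)) with (s * s * ((1 - c) * (1 - c)) / 16) by field.
    replace (s * s) with (1 - c * c) by lra.
    field [Hw]. }
assert (E : D * (M - Pform c s p q z) =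
  (D * z + b * p) * (D * z + b * p) + (A * D - b * b) * (p * p) + A * D * (q * q)).
{ replace M with (M * (p * p + q * q + z * z)) at 1 by (rewrite Hm; ring).
  unfold Pform, A, D, b; field. }
assert (0 <= D * (M - Pform c s p q z)).
{ rewrite E; repeat apply Rplus_le_le_0_compat.
  - apply Rle_0_sqr.
  - apply Rmult_le_pos; [exact Hdet | apply Rle_0_sqr].
  - apply Rmult_le_pos; [nra | apply Rle_0_sqr]. }
nra.
Qed.

Lemma Pfun_Zm a1 b1 g1 a2 b2 g2 :
  Pfun (Zm a1 b1 g1) (Zm a2 b2 g2) =
  Pform (cos b1) (sin b1) (sin b2 * cos g2 * cos a1 - sin b2 * sin g2 * sin a1)
    (sin b2 * cos g2 * sin a1 + sin b2 * sin g2 * cos a1) (cos b2).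
Proof. exact (Pfun_Pform _ _ _ _ _ _ _ _ _ (Zm_state a1 b1 g1) (Zm_row a2 b2 g2)). Qed.

Lemma cos_sin_sqr t : cos t * cos t + sin t * sin t = 1.
Proof. pose proof (sin2_cos2 t); unfold Rsqr in *; lra. Qed.

Lemma row_norm m1 m2 m3 a : m1 * m1 + m2 * m2 + m3 * m3 = 1 ->
  (m1 * cos a - m2 * sin a) * (m1 * cos a - m2 * sin a)
  + (m1 * sin a + m2 * cos a) * (m1 * sin a + m2 * cos a) + m3 * m3 = 1.
Proof.
intros H; transitivity ((m1 * m1 + m2 * m2) * (cos a * cos a + sin a * sin a) + m3 * m3);
  [ring | rewrite cos_sin_sqr, Rmult_1_r; exact H].
Qed.

Lemma Zm_row_norm b g :
  sin b * cos g * (sin b * cos g) + sin b * sin g * (sin b * sin g) + cos b * cos b = 1.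
Proof.
transitivity (sin b * sin b * (cos g * cos g + sin g * sin g) + cos b * cos b); [ring |].
rewrite cos_sin_sqr; pose proof (cos_sin_sqr b); lra.
Qed.

Lemma Pfun_le a1 b1 g1 a2 b2 g2 :
  Pfun (Zm a1 b1 g1) (Zm a2 b2 g2) <= 3 / 50 * (9 + sqrt 6).
Proof. rewrite Pfun_Zm; apply Pform_le; [apply cos_sin_sqr | apply row_norm, Zm_row_norm]. Qed.

Lemma Pfun_max_attained : exists b1 b2,
  Pfun (Zm 0 b1 0) (Zm 0 b2 0) = 3 / 50 * (9 + sqrt 6).
Proof.
destruct sqrt6_bounds as (Hw & Hw1 & Hw2).
set (c := (1 - sqrt 6) / 5).
assert (Hc : cos (acos c) = c) by (apply cos_acos; unfold c; lra).
set (s := sin (acos c)).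
assert (Hs : s * s = 1 - c * c).
{ pose proof (cos_sin_sqr (acos c)) as H; rewrite Hc in H; fold s in H; lra. }
set (T := - (s * (4 - sqrt 6) / 2)).
exists (acos c), (atan T); rewrite Pfun_Zm, Hc; fold s; rewrite cos_0, sin_0, sin_atan, cos_atan.
set (N := sqrt (1 + T²)).
assert (HT : 0 < 1 + T²) by (pose proof (Rle_0_sqr T); lra).
assert (HN : 0 < N) by (apply sqrt_lt_R0; exact HT).
assert (HN2 : N * N = 1 + T * T) by (apply sqrt_sqrt; unfold Rsqr in HT; lra).
replace (Pform _ _ _ _ _) with
  ((T * T * (1 + c * c) / 4 + s * s / 2 - T * s * (1 - c) / 2) / (N * N))
  by (unfold Pform; field; lra).
rewrite HN2.
replace (T * s) with (- (s * s * (4 - sqrt 6) / 2)) by (unfold T; field).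
replace (T * T) with (s * s * ((4 - sqrt 6) * (4 - sqrt 6) / 4)) in * by (unfold T; field).
rewrite Hs in *; unfold c in *.
set (w := sqrt 6) in *; clearbody w; clear - Hw HN HN2.
assert (0 < N * N) by nra.
apply Rmult_eq_reg_r with (1 + (1 - (1 - w) / 5 * ((1 - w) / 5)) * ((4 - w) * (4 - w) / 4));
  [| lra].
unfold Rdiv at 1; rewrite Rmult_assoc, Rinv_l, Rmult_1_r by lra.
field [Hw].
Qed.

Lemma global_max_value a1 b1 g1 a2 b2 g2 : global_max (Zm a1 b1 g1) (Zm a2 b2 g2) ->
  Pfun (Zm a1 b1 g1) (Zm a2 b2 g2) = 3 / 50 * (9 + sqrt 6).
Proof.
intros H; destruct Pfun_max_attained as (b & b' & Hb).
apply Rle_antisym; [apply Pfun_le | rewrite <- Hb; apply H].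
Qed.

Definition Pbil (c s p q z P Q Z : R) : R :=
  (p * P + q * Q) * (1 + c * c) / 4 + z * Z * (s * s) / 2 - s * (1 - c) * (z * P + p * Z) / 4.

Lemma local_min_row a1 b1 g1 a2 b2 g2 m1 m2 m3 u1 u2 u3 :
  local_min (Zm a1 b1 g1) (Zm a2 b2 g2) ->
  is_row (Zm a2 b2 g2) m1 m2 m3 -> m1 * m1 + m2 * m2 + m3 * m3 = 1 ->
  u1 * u1 + u2 * u2 + u3 * u3 = 1 -> m1 * u1 + m2 * u2 + m3 * u3 = 0 ->
  let p := m1 * cos a1 - m2 * sin a1 in let q := m1 * sin a1 + m2 * cos a1 in
  let P := u1 * cos a1 - u2 * sin a1 in let Q := u1 * sin a1 + u2 * cos a1 in
  Pbil (cos b1) (sin b1) p q m3 P Q u3 = 0 /\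
  Pform (cos b1) (sin b1) p q m3 <= Pform (cos b1) (sin b1) P Q u3.
Proof.
intros (eps & He & Hmin) Hrow Hm Hu Ho p q P Q.
set (x := m3 * u2 - m2 * u3); set (y := m3 * u1 - m1 * u3); set (z := m1 * u2 - m2 * u1).
set (L := Pform (cos b1) (sin b1) p q m3); set (C := Pform (cos b1) (sin b1) P Q u3).
set (B := Pbil (cos b1) (sin b1) p q m3 P Q u3).
set (v := fun t k => match k with 3%nat => t * x | 4%nat => t * y | 5%nat => t * z | _ => 0 end).
set (h := fun t => cos t * cos t * L + 2 * (cos t * sin t) * B + sin t * sin t * C).
assert (Hh : forall t, Ploc (Zm a1 b1 g1) (Zm a2 b2 g2) (v t) = h t).
{ intros t; unfold Ploc; simpl v.
  pose proof (is_row_great_circle _ _ _ _ _ _ _ t Hrow Hm Hu Ho) as R1.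
  fold x y z in R1.
  rewrite (Pfun_Pform _ _ _ _ _ _ _ _ _ (is_state_chartR_0 a1 b1 g1) R1).
  unfold h, L, B, C, Pform, Pbil, p, q, P, Q; field. }
set (N := 1 + Rabs x + Rabs y + Rabs z).
pose proof (Rabs_pos x); pose proof (Rabs_pos y); pose proof (Rabs_pos z).
destruct (local_min_second_order h
  (fun t => 2 * (cos t * sin t) * (C - L) + 2 * (cos t * cos t - sin t * sin t) * B)
  (2 * (C - L)) (eps / N)) as [E1 E2].
- intros t; unfold h; auto_derive; [exact I | ring].
- auto_derive; [exact I |]; rewrite sin_0, cos_0; ring.
- apply Rdiv_lt_0_compat; unfold N; lra.
- intros t Ht; rewrite <- !Hh.
  assert (Hv0 : v 0 = fun _ => 0).
  { apply functional_extensionality; intros k; unfold v.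
    do 6 (destruct k as [|k]; [try reflexivity; apply Rmult_0_l |]); reflexivity. }
  rewrite Hv0; apply Hmin.
  assert (Ht' : Rabs t * N < eps).
  { apply Rmult_lt_reg_r with (/ N); [apply Rinv_0_lt_compat; unfold N; lra |].
    rewrite Rmult_assoc, Rinv_r, Rmult_1_r by (unfold N; lra); exact Ht. }
  assert (Hle : forall r, Rabs r <= N -> Rabs (t * r) < eps).
  { intros r Hr; rewrite Rabs_mult; apply Rle_lt_trans with (Rabs t * N); [| exact Ht'].
    apply Rmult_le_compat_l; [apply Rabs_pos | exact Hr]. }
  intros k Hk; unfold v.
  do 6 (destruct k as [|k]; [first [rewrite Rabs_R0; exact He | apply Hle; unfold N; lra] |]); lia.
- rewrite sin_0, cos_0 in E1; split; lra.
Qed.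

Lemma local_min_state a1 b1 g1 a2 b2 g2 m1 m2 m3 :
  local_min (Zm a1 b1 g1) (Zm a2 b2 g2) -> is_row (Zm a2 b2 g2) m1 m2 m3 ->
  let p := m1 * cos a1 - m2 * sin a1 in let q := m1 * sin a1 + m2 * cos a1 in
  let c := cos b1 in let s := sin b1 in
  - (p * p + q * q) * (c * s) / 2 + m3 * m3 * (s * c) - m3 * p * (c - c * c + s * s) / 2 = 0 /\
  0 <= (p * p + q * q) * (s * s - c * c) / 2 + m3 * m3 * (c * c - s * s)
       - m3 * p * (4 * (s * c) - s) / 2.
Proof.
intros (eps & He & Hmin) Hrow p q c s.
set (v := fun t k => match k with 0%nat => t * sin g1 | 1%nat => t * cos g1 | _ => 0 end).
set (h := fun t => Pform (cos (b1 + t)) (sin (b1 + t)) p q m3).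
assert (Hh : forall t, Ploc (Zm a1 b1 g1) (Zm a2 b2 g2) (v t) = h t).
{ intros t; unfold Ploc; simpl v.
  exact (Pfun_Pform _ _ _ _ _ _ _ _ _ (is_state_chartR_Zm a1 b1 g1 t) (is_row_chartR_0 _ _ _ _ Hrow)). }
destruct (local_min_second_order h
  (fun t => - (p * p + q * q) * (cos (b1 + t) * sin (b1 + t)) / 2
    + m3 * m3 * (sin (b1 + t) * cos (b1 + t))
    - m3 * p * (cos (b1 + t) - cos (b1 + t) * cos (b1 + t) + sin (b1 + t) * sin (b1 + t)) / 2)
  ((p * p + q * q) * (s * s - c * c) / 2 + m3 * m3 * (c * c - s * s)
       - m3 * p * (4 * (s * c) - s) / 2) eps) as [E1 E2].
- intros t; unfold h, Pform; auto_derive; [exact I | field].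
- auto_derive; [exact I |]; rewrite Rplus_0_r; fold c s; field.
- exact He.
- intros t Ht; rewrite <- !Hh.
  assert (Hv0 : v 0 = fun _ => 0).
  { apply functional_extensionality; intros k; unfold v.
    do 2 (destruct k as [|k]; [apply Rmult_0_l |]); reflexivity. }
  rewrite Hv0; apply Hmin.
  assert (Hle : forall r, -1 <= r <= 1 -> Rabs (t * r) < eps).
  { intros r Hr; rewrite Rabs_mult; apply Rle_lt_trans with (Rabs t * 1); [| lra].
    apply Rmult_le_compat_l; [apply Rabs_pos | apply Rabs_le; exact Hr]. }
  intros k Hk; unfold v.
  do 2 (destruct k as [|k]; [apply Hle; first [apply SIN_bound | apply COS_bound] |]).
  rewrite Rabs_R0; exact He.
- rewrite Rplus_0_r in E1; split; assumption.
Qed.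

(* Here [t] is [tan y / s], where [(p, q, z) = (sin y, 0, cos y)]; eliminating it
   leaves [(5 c^2 - 2 c - 1) (c^2 + c - 1) = 0], and the first factor forces [t < 0]. *)
Lemma no_interior_min c t : -1 < c < 1 -> 0 < t ->
  t * (3 * (c * c) - 1) = (1 - c) * (1 - (1 - c * c) * (t * t)) ->
  2 * c - (1 - c * c) * (t * t) * c - t * ((1 - c) * (1 + 2 * c)) = 0 ->
  (1 - c * c) * (t * t) * (1 - 2 * (c * c)) / 2 + (2 * (c * c) - 1)
    - (1 - c * c) * t * (4 * c - 1) / 2 < 0.
Proof.
intros Hc Ht E1 E2.
set (N := 1 + c - 3 * (c * c) - c * (c * c)).
assert (EN : t * N = c * (1 - c)).
{ assert (X : (1 - c) * (2 * c - (1 - c * c) * (t * t) * c - t * ((1 - c) * (1 + 2 * c)))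
    - c * ((1 - c) * (1 - (1 - c * c) * (t * t)) - t * (3 * (c * c) - 1)) = 0)
    by (rewrite E2, E1; ring).
  unfold N; lra. }
assert (EF : (1 - c) * ((c + 1) * (c + 1))
  * ((5 * (c * c) - 2 * c - 1) * (c * c + c - 1)) = 0).
{ transitivity (N * N * ((1 - c) * (1 - (1 - c * c) * (t * t)) - t * (3 * (c * c) - 1))
    + (1 - c) * (1 - c * c) * ((t * N - c * (1 - c)) * (t * N + c * (1 - c)))
    + N * (3 * (c * c) - 1) * (t * N - c * (1 - c))).
  - unfold N; ring.
  - rewrite E1, EN; ring. }
apply Rmult_integral in EF; destruct EF as [EF | EF].
{ apply Rmult_integral in EF; destruct EF as [EF | EF]; [lra | nra]. }
apply Rmult_integral in EF; destruct EF as [EF | EF].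
- exfalso.
  assert (Hq : c * c = (2 * c + 1) / 5) by lra.
  assert (X : t * (8 - 14 * c) = 5 * (3 * c - 1)).
  { assert (HN : N = (8 - 14 * c) / 25).
    { unfold N; rewrite Hq; replace (c * ((2 * c + 1) / 5)) with ((2 * (c * c) + c) / 5) by field.
      rewrite Hq; field. }
    rewrite HN in EN; replace (c * (1 - c)) with (c - c * c) in EN by ring.
    rewrite Hq in EN; lra. }
  assert (Hc1 : c < 0.77) by nra.
  assert (Y : t * ((8 - 14 * c) * (8 - 14 * c)) = 5 * ((3 * c - 1) * (8 - 14 * c)))
    by (rewrite <- Rmult_assoc, X; ring).
  assert (Z : (3 * c - 1) * (8 - 14 * c) = (106 * c - 82) / 5).
  { transitivity (38 * c - 8 - 42 * (c * c)); [ring | rewrite Hq; field]. }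
  rewrite Z in Y.
  assert (0 <= t * ((8 - 14 * c) * (8 - 14 * c)))
    by (apply Rmult_le_pos; [lra | apply Rle_0_sqr]).
  lra.
- assert (Hq : c * c = 1 - c) by lra.
  assert (Hc0 : 0 < c) by nra.
  assert (Ht1 : t = 1).
  { assert (HN : N = 2 * c - 1).
    { unfold N; rewrite Hq; replace (c * (1 - c)) with (c - c * c) by ring; rewrite Hq; ring. }
    rewrite HN in EN; replace (c * (1 - c)) with (c - c * c) in EN by ring; rewrite Hq in EN.
    assert (X : (2 * c - 1) * (t - 1) = 0) by lra.
    apply Rmult_integral in X; destruct X; [nra | lra]. }
  rewrite Ht1, Hq.
  replace ((1 - (1 - c)) * (1 * 1) * (1 - 2 * (1 - c)) / 2 + (2 * (1 - c) - 1)
    - (1 - (1 - c)) * 1 * (4 * c - 1) / 2) with (1 - 2 * c - c * c) by field.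
  lra.
Qed.

Lemma stationary_min_zero c s p q z :
  c * c + s * s = 1 -> p * p + q * q + z * z = 1 ->
  (forall P Q Z, P * P + Q * Q + Z * Z = 1 -> p * P + q * Q + z * Z = 0 ->
     Pbil c s p q z P Q Z = 0 /\ Pform c s p q z <= Pform c s P Q Z) ->
  - (p * p + q * q) * (c * s) / 2 + z * z * (s * c) - z * p * (c - c * c + s * s) / 2 = 0 ->
  0 <= (p * p + q * q) * (s * s - c * c) / 2 + z * z * (c * c - s * s)
       - z * p * (4 * (s * c) - s) / 2 ->
  Pform c s p q z <= 0.
Proof.
intros Hcs Hm Hrow Hx Hxx.
set (l := Pform c s p q z) in *.
assert (Hall : forall P Q Z, Pbil c s p q z P Q Z = l * (p * P + q * Q + z * Z) /\
  l * (P * P + Q * Q + Z * Z) <= Pform c s P Q Z).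
{ intros P Q Z.
  set (k := p * P + q * Q + z * Z).
  set (P' := P - k * p); set (Q' := Q - k * q); set (Z' := Z - k * z).
  assert (Hk : p * P' + q * Q' + z * Z' = 0).
  { transitivity (k - k * (p * p + q * q + z * z)); [unfold P', Q', Z', k; ring | rewrite Hm; ring]. }
  assert (HB : Pbil c s p q z P Q Z = Pbil c s p q z P' Q' Z' + k * l)
    by (unfold l, Pbil, Pform, P', Q', Z'; field).
  assert (HF : Pform c s P Q Z = Pform c s P' Q' Z' + 2 * k * Pbil c s p q z P' Q' Z' + k * k * l)
    by (unfold l, Pbil, Pform, P', Q', Z'; field).
  assert (HN : P * P + Q * Q + Z * Z = P' * P' + Q' * Q' + Z' * Z' + k * k).
  { transitivity (P' * P' + Q' * Q' + Z' * Z' + 2 * k * (p * P' + q * Q' + z * Z')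
      + k * k * (p * p + q * q + z * z));
    [unfold P', Q', Z'; ring | rewrite Hk, Hm; ring]. }
  rewrite HB, HF, HN; clearbody P' Q' Z'.
  set (n2 := P' * P' + Q' * Q' + Z' * Z').
  assert (X : Pbil c s p q z P' Q' Z' = 0 /\ l * n2 <= Pform c s P' Q' Z').
  { destruct (Req_dec n2 0) as [H0 | H0].
    - assert (P' = 0 /\ Q' = 0 /\ Z' = 0) as (-> & -> & ->) by (unfold n2 in H0; repeat split; nra).
      rewrite H0; unfold Pbil, Pform; lra.
    - assert (Hp : 0 < n2) by (assert (0 <= n2) by (unfold n2; nra); lra).
      set (n := sqrt n2); assert (Hn : 0 < n) by (apply sqrt_lt_R0; exact Hp).
      assert (Hn2 : n * n = n2) by (apply sqrt_sqrt; lra).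
      destruct (Hrow (P' / n) (Q' / n) (Z' / n)) as [R1 R2].
      + transitivity (n2 / (n * n)); [unfold n2; field; lra | rewrite Hn2; field; lra].
      + transitivity ((p * P' + q * Q' + z * Z') / n); [field; lra | rewrite Hk; field; lra].
      + assert (E1 : Pbil c s p q z P' Q' Z' = n * Pbil c s p q z (P' / n) (Q' / n) (Z' / n))
          by (unfold Pbil; field; lra).
        assert (E2 : Pform c s P' Q' Z' = n * n * Pform c s (P' / n) (Q' / n) (Z' / n))
          by (unfold Pform; field; lra).
        rewrite E1, E2, R1, Hn2; split; [ring |].
        rewrite Rmult_comm; apply Rmult_le_compat_l; lra. }
  destruct X as [X1 X2]; rewrite X1; split; lra. }
destruct (Req_dec s 0) as [Hs | Hs].
{ destruct (Hall 0 0 1) as [_ H]; unfold Pform in H; rewrite Hs in H; lra. }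
exfalso.
assert (Hc : -1 < c < 1) by nra.
set (A := (1 + c * c) / 4 - l); set (b := s * (1 - c) / 4).
assert (Hb : b <> 0) by (unfold b; apply Rmult_integral_contrapositive_currified; [| lra];
  apply Rmult_integral_contrapositive_currified; lra).
assert (HA : 0 < A).
{ assert (HA0 : 0 <= A) by (destruct (Hall 1 0 0) as [_ H]; unfold Pform in H; unfold A; lra).
  destruct (Rle_lt_or_eq_dec _ _ HA0) as [H | H]; [exact H | exfalso].
  set (D := s * s / 2 - l).
  destruct (Hall ((D + 1) / (2 * b)) 0 1) as [_ X].
  replace (Pform _ _ _ _ _) with
    (l * ((D + 1) / (2 * b) * ((D + 1) / (2 * b)) + 0 * 0 + 1 * 1)
     + A * ((D + 1) / (2 * b) * ((D + 1) / (2 * b))) + D - 2 * b * ((D + 1) / (2 * b))) in X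
    by (unfold Pform, A, D, b; field; fold b; lra).
  rewrite <- H in X; replace (2 * b * ((D + 1) / (2 * b))) with (D + 1) in X by (field; lra).
  lra. }
assert (Hq : q = 0).
{ destruct (Hall 0 1 0) as [X _]; unfold Pbil in X.
  assert (Y : A * q = 0) by (unfold A; lra).
  apply Rmult_integral in Y; destruct Y; lra. }
assert (Hp : A * p = b * z) by (destruct (Hall 1 0 0) as [X _]; unfold Pbil in X; unfold A, b; lra).
assert (Hz : (s * s / 2 - l) * z = b * p)
  by (destruct (Hall 0 0 1) as [X _]; unfold Pbil in X; unfold b; lra).
assert (Hz0 : z <> 0).
{ intros H; rewrite H in Hz, Hm; rewrite Rmult_0_r in Hz; symmetry in Hz.
  apply Rmult_integral in Hz; destruct Hz as [Hz | Hz]; [lra |].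
  rewrite Hz, Hq in Hm; lra. }
set (t := (1 - c) / (4 * A)).
assert (Ht : 0 < t) by (apply Rdiv_lt_0_compat; lra).
assert (Hpt : p = s * t * z).
{ apply Rmult_eq_reg_l with A; [| lra]; rewrite Hp; unfold b, t; field; lra. }
assert (HAt : A * t = (1 - c) / 4) by (unfold t; field; lra).
assert (Hss : s * s = 1 - c * c) by lra.
rewrite Hq, Hpt in Hx, Hxx.
assert (E1 : t * (3 * (c * c) - 1) = (1 - c) * (1 - (1 - c * c) * (t * t))).
{ assert (X : s * s / 2 - l = s * s * (1 - c) * t / 4).
  { apply Rmult_eq_reg_r with z; [| exact Hz0]; rewrite Hz, Hpt; unfold b; field. }
  assert (Y : t * (s * s / 2 - l) - A * t = t * (s * s * (1 - c) * t / 4) - (1 - c) / 4)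
    by (rewrite X, HAt; reflexivity).
  unfold A in Y; rewrite Hss in Y; lra. }
assert (E2 : 2 * c - (1 - c * c) * (t * t) * c - t * ((1 - c) * (1 + 2 * c)) = 0).
{ apply Rmult_eq_reg_l with (z * z * s / 2).
  - rewrite Rmult_0_r, <- Hx, <- Hss; field [Hss].
  - repeat apply Rmult_integral_contrapositive_currified; lra. }
pose proof (no_interior_min c t Hc Ht E1 E2) as E3.
assert (Hzz : 0 < z * z) by nra.
assert (X : z * z * ((1 - c * c) * (t * t) * (1 - 2 * (c * c)) / 2 + (2 * (c * c) - 1)
    - (1 - c * c) * t * (4 * c - 1) / 2) < 0).
{ rewrite <- (Rmult_0_r (z * z)); apply Rmult_lt_compat_l; assumption. }
apply (Rlt_not_le _ _ X); refine (Rle_trans _ _ _ Hxx _); apply Req_le.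
field [Hss].
Qed.

Lemma local_min_zero a1 b1 g1 a2 b2 g2 : local_min (Zm a1 b1 g1) (Zm a2 b2 g2) ->
  Pfun (Zm a1 b1 g1) (Zm a2 b2 g2) = 0.
Proof.
intros Hmin; apply Rle_antisym; [| apply Pfun_nonneg].
pose proof (Zm_row a2 b2 g2) as Hrow; pose proof (Zm_row_norm b2 g2) as Hm.
destruct (local_min_state _ _ _ _ _ _ _ _ _ Hmin Hrow) as [Hx Hxx].
rewrite Pfun_Zm; apply stationary_min_zero; try assumption;
  [apply cos_sin_sqr | apply row_norm, Hm |].
intros P Q Z HU HO.
pose proof (cos_sin_sqr a1) as Ha.
destruct (local_min_row _ _ _ _ _ _ _ _ _ (P * cos a1 + Q * sin a1)
  (- P * sin a1 + Q * cos a1) Z Hmin Hrow Hm) as [R1 R2].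
- transitivity ((P * P + Q * Q) * (cos a1 * cos a1 + sin a1 * sin a1) + Z * Z);
    [ring | rewrite Ha; lra].
- rewrite <- HO; ring.
- cbv zeta in R1, R2.
  replace ((P * cos a1 + Q * sin a1) * cos a1 - (- P * sin a1 + Q * cos a1) * sin a1)
    with P in R1, R2
    by (transitivity (P * (cos a1 * cos a1 + sin a1 * sin a1)); [rewrite Ha |]; ring).
  replace ((P * cos a1 + Q * sin a1) * sin a1 + (- P * sin a1 + Q * cos a1) * cos a1)
    with Q in R1, R2
    by (transitivity (Q * (cos a1 * cos a1 + sin a1 * sin a1)); [rewrite Ha |]; ring).
  split; assumption.
Qed.

Theorem theorem1 :
  forall a1 b1 g1 a2 b2 g2 : R,
    let U1 := Zm a1 b1 g1 in
    let U2 := Zm a2 b2 g2 in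
    critical U1 U2 ->
    (global_min U1 U2 /\ Pfun U1 U2 = 0)
    \/ saddle U1 U2
    \/ second_order_trap U1 U2
    \/ (global_max U1 U2 /\ Pfun U1 U2 = 3 / 50 * (9 + sqrt 6)).
Proof.
intros a1 b1 g1 a2 b2 g2 U1 U2 Hcrit.
destruct (classic (local_max U1 U2)) as [Hmax | Hmax].
- right; right.
  destruct (classic (global_max U1 U2)) as [Hg | Hg].
  + right; split; [exact Hg | apply global_max_value; exact Hg].
  + left; split; [exact Hcrit | split; [exact Hg | split]].
    * apply local_max_hess_nsd; exact Hmax.
    * apply not_hess_nd.
- destruct (classic (local_min U1 U2)) as [Hmin | Hmin].
  + left; apply local_min_zero in Hmin; split; [| exact Hmin].
    intros a1' b1' g1' a2' b2' g2'; unfold U1, U2; rewrite Hmin; apply Pfun_nonneg.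
  + right; left; split; [exact Hcrit | split; assumption].
Qed.
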